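(* Let $\delta t>0$ be arbitrary, let $\eta\in[0,1]$, and let $(\phi^n)_{0\le n\le N}$, $(\mu^{n+\frac12})_{1\le n\le N-1}$, $(\tilde q^{\,n+1})_{1\le n\le N-1}$ and $(q^n)_{1\le n\le N}$ satisfy the second-order RSAV-CN scheme with time step $\delta t$ (defined in the context), with an arbitrary admissible relaxation parameter $\xi_0\in\mathcal V$ chosen at each step. Then the scheme is unconditionally energy stable: with $$E^{n}_{\mathrm{CN}}=\frac12(\phi^{n},(\mathcal L+\gamma_0 I)\phi^{n})+(q^{n})^2,$$ one has $E^{n+1}_{\mathrm{CN}}\le E^{n}_{\mathrm{CN}}$ for every $1\le n\le N-1$, with no restriction on the size of $\delta t$.
   Context: Setting. $\Omega$ is a bounded rectangular domain with periodic boundary conditions; functions are real-valued and sufficiently regular for all expressions to make sense. $(f,g)=\int_\Omega fg\,d\mathbf x$ and $I$ is the identity operator. The free energy is $\mathcal E(\phi)=\int_\Omega\big(\frac12\phi\mathcal L\phi+F(\phi)\big)d\mathbf x$, where $\mathcal L$ is a linear operator, symmetric with respect to $(\cdot,\cdot)$, and $F:\mathbb R\to\mathbb R$ is continuously differentiable. The constant $\gamma_0$ is a real regularization parameter. The mobility $\mathcal G$ is an operator that is positive semidefinite, $(\mathcal G f,f)\ge 0$ for all $f$ (or skew-symmetric, in which case $(\mathcal G f,f)=0$). The gradient flow approximated is $\partial_t\phi=-\mathcal G(\mathcal L\phi+F'(\phi))$. Put $$Q(\phi)=\sqrt{\int_\Omega\big(F(\phi)-\tfrac12\gamma_0\phi^2\big)d\mathbf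 x+C_0},\qquad V(\phi)=F'(\phi)-\gamma_0\phi,$$ where the constant $C_0>0$ is such that the quantity under the square root is positive for all functions at which $Q$ is evaluated. RSAV-CN scheme. Starting data $\phi^0,\phi^1$ (functions) and $q^1$ (real number) are given. For $1\le n\le N-1$, let $\overline\phi^{\,n+\frac12}=\frac32\phi^n-\frac12\phi^{n-1}$, $\phi^{n+\frac12}=\frac12(\phi^{n+1}+\phi^n)$ and $\tilde q^{\,n+\frac12}=\frac12(\tilde q^{\,n+1}+q^n)$. Step 1: $\phi^{n+1},\mu^{n+\frac12}$ (functions) and $\tilde q^{\,n+1}$ (real number) satisfy $$\frac{\phi^{n+1}-\phi^n}{\delta t}=-\mathcal G\mu^{n+\frac12},$$ $$\mu^{n+\frac12}=\mathcal L\phi^{n+\frac12}+\gamma_0\phi^{n+\frac12}+\frac{\tilde q^{\,n+\frac12}}{Q(\overline\phi^{\,n+\frac12})}V(\overline\phi^{\,n+\frac12}),$$ $$\frac{\tilde q^{\,n+1}-q^n}{\delta t}=\int_\Omega\frac{V(\overline\phi^{\,n+\frac12})}{2Q(\overline\phi^{\,n+\frac12})}\,\frac{\phi^{n+1}-\phi^n}{\delta t}\,d\mathbf x.$$ Step 2 (relaxation): $q^{n+1}=\xi_0\tilde q^{\,n+1}+(1-\xi_0)Q(\phi^{n+1})$ for some $\xi_0\in\mathcal V$ ($\xi_0$ may depend on $n$), where $\mathcal V$ is the set of all $\xi\in[0,1]$ such that, with $r=\xi\tilde q^{\,n+1}+(1-\xi)Q(\phi^{n+1})$, $$r^2-(\tilde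 q^{\,n+1})^2\le\delta t\,\eta\,(\mathcal G\mu^{n+\frac12},\mu^{n+\frac12}).$$ *)

(* Defs.v *)
From HB Require Import structures.
From mathcomp Require Import all_boot all_order all_algebra.
From mathcomp Require Import all_classical all_reals all_analysis.
Set Implicit Arguments.
Unset Strict Implicit.
Unset Printing Implicit Defensive.
Import Order.TTheory GRing.Theory Num.Theory.
Import numFieldNormedType.Exports.
Local Open Scope classical_set_scope.
Local Open Scope ring_scope.

Lemma measurable_tuple_cons (R : realType) (d : nat) :
  measurable_fun [set: d.-tuple R * R] (fun p => [the d.+1.-tuple R of p.2 :: p.1]).
Proof. exact: (measurable_cons measurable_snd measurable_fst). Qed.

(* Lebesgue measure on R^d, transported along R^d * R ~ R^(d+1); the library
   provides the sigma-algebra on tuples but no measure on it. *)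
Fixpoint lebesgue (R : realType) (d : nat) : {measure set (d.-tuple R) -> \bar R} :=
  match d with
  | 0 => \d_([tuple] : 0.-tuple R)
  | d'.+1 =>
      measure_function_pushforward__canonical__measure_function_Measure
        (lebesgue R d' \x @lebesgue_measure R)%E (@measurable_tuple_cons R d')
  end.

Definition box (R : realType) (d : nat) (a b : d.-tuple R) : set (d.-tuple R) :=
  [set x | forall i, tnth a i < tnth x i < tnth b i].

Lemma measurable_box (R : realType) (d : nat) (a b : d.-tuple R) :
  measurable (box a b).
Proof.
rewrite (_ : box a b = \bigcap_(i in [set: 'I_d])
  ((fun x => tnth x i) @^-1` `]tnth a i, tnth b i[%classic)).
  apply: fin_bigcap_measurable => [|i _]; first exact: finite_finset.
  by rewrite -[X in measurable X]setTI; exact: measurable_tnth.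
apply/seteqP; split=> x /= h i; first by move=> _; rewrite /= in_itv /= h.
by have := h i I; rewrite /= in_itv.
Qed.

Lemma lebesgue_box (R : realType) (d : nat) (a b : d.-tuple R) :
  (forall i, tnth a i <= tnth b i) ->
  lebesgue R d (box a b) = (\prod_(i < d) (tnth b i - tnth a i))%:E.
Proof.
elim: d a b => [|d IH] a b ab.
  by rewrite big_ord0 /= diracE mem_set// => -[].
case/tupleP: a ab => a0 a ab; case/tupleP: b ab => b0 b ab.
rewrite big_ord_recl !tnth0 /= /pushforward.
rewrite (_ : _ @^-1` _ = box a b `*` `]a0, b0[%classic); last first.
  apply/seteqP; split=> -[x x0] /= => [h|[h]].
    split; first by move=> i; have := h (lift ord0 i); rewrite !tnthS.
    by rewrite in_itv /=; have := h ord0; rewrite !tnth0.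
  rewrite in_itv /= => h0 i; case: (unliftP ord0 i) => [j ->|->].
    by rewrite !tnthS.
  by rewrite !tnth0.
rewrite product_measure1E//; [|exact: measurable_box].
rewrite IH; last by move=> i; have := ab (lift ord0 i); rewrite !tnthS.
set mu0 := (X in (_ * X)%E).
have -> : mu0 = (if (a0 < b0)%R then (b0 - a0)%:E else 0)%E.
  by rewrite /mu0 [LHS](lebesgue_measure_itv `]a0, b0[) /= lte_fin EFinB.
have := ab ord0; rewrite !tnth0 le_eqVlt => /orP[/eqP->|->].
  by rewrite ltxx mule0 subrr mul0r.
rewrite -EFinM mulrC; congr (_ * _)%:E.
by apply: eq_bigr => i _; rewrite !tnthS.
Qed.

Definition integral_box (R : realType) (d : nat) (a b : d.-tuple R)
    (f : d.-tuple R -> R) : R :=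
  \int[lebesgue R d]_(x in box a b) f x.

Definition dot (R : realType) (d : nat) (a b : d.-tuple R)
    (f g : d.-tuple R -> R) : R :=
  integral_box a b (fun x => f x * g x).

Definition shift_period (R : realType) (d : nat) (a b : d.-tuple R) (i : 'I_d)
    (x : d.-tuple R) : d.-tuple R :=
  [tuple tnth x j + (if j == i then tnth b i - tnth a i else 0) | j < d].

Definition periodic (R : realType) (d : nat) (a b : d.-tuple R)
    (f : d.-tuple R -> R) : Prop :=
  forall i x, f (shift_period a b i x) = f x.

(* The ambient space: periodic functions, square integrable over one period
   cell, so that every inner product below is a genuine integral. *)
Definition periodicL2 (R : realType) (d : nat) (a b : d.-tuple R) :
    set (d.-tuple R -> R) :=
  [set f | [/\ periodic a b f, measurable_fun (box a b) f &
    (lebesgue R d).-integrable (box a b) (fun x => (f x ^+ 2)%:E)]].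

(* Operators are given with a domain D of sufficiently regular functions. Their
   values outside D are irrelevant. *)
Definition operator_on (R : realType) (d : nat) (a b : d.-tuple R)
    (D : set (d.-tuple R -> R)) (A : (d.-tuple R -> R) -> (d.-tuple R -> R)) :
    Prop :=
  D `<=` periodicL2 a b /\ (forall f, D f -> periodicL2 a b (A f)).

Definition linear_on (R : realType) (d : nat) (D : set (d.-tuple R -> R))
    (A : (d.-tuple R -> R) -> (d.-tuple R -> R)) : Prop :=
  D (fun=> 0) /\
  forall (c : R) f g, D f -> D g ->
    D (fun x => c * f x + g x) /\
    A (fun x => c * f x + g x) = (fun x => c * A f x + A g x).

Definition symmetric_on (R : realType) (d : nat) (a b : d.-tuple R)
    (D : set (d.-tuple R -> R)) (A : (d.-tuple R -> R) -> (d.-tuple R -> R)) :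
    Prop :=
  forall f g, D f -> D g -> dot a b (A f) g = dot a b f (A g).

Definition positive_semidefinite_on (R : realType) (d : nat) (a b : d.-tuple R)
    (D : set (d.-tuple R -> R)) (A : (d.-tuple R -> R) -> (d.-tuple R -> R)) :
    Prop :=
  forall f, D f -> 0 <= dot a b (A f) f.

Definition skew_symmetric_on (R : realType) (d : nat) (a b : d.-tuple R)
    (D : set (d.-tuple R -> R)) (A : (d.-tuple R -> R) -> (d.-tuple R -> R)) :
    Prop :=
  forall f g, D f -> D g -> dot a b (A f) g = - dot a b f (A g).

Definition C1 (R : realType) (F : R -> R) : Prop :=
  (forall x, derivable F x 1) /\ continuous (derive1 F).

Definition Qsq (R : realType) (d : nat) (a b : d.-tuple R) (F : R -> R)
    (gamma0 C0 : R) (phi : d.-tuple R -> R) : R :=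
  integral_box a b (fun x => F (phi x) - 1 / 2 * gamma0 * phi x ^+ 2) + C0.

Definition Q (R : realType) (d : nat) (a b : d.-tuple R) (F : R -> R)
    (gamma0 C0 : R) (phi : d.-tuple R -> R) : R :=
  Num.sqrt (Qsq a b F gamma0 C0 phi).

Definition V (R : realType) (d : nat) (F : R -> R) (gamma0 : R)
    (phi : d.-tuple R -> R) : d.-tuple R -> R :=
  fun x => derive1 F (phi x) - gamma0 * phi x.

Definition Q_admissible (R : realType) (d : nat) (a b : d.-tuple R) (F : R -> R)
    (gamma0 C0 : R) (phi : d.-tuple R -> R) : Prop :=
  (lebesgue R d).-integrable (box a b) (fun x => (F (phi x))%:E) /\
  0 < Qsq a b F gamma0 C0 phi.

Definition extrapolate (R : realType) (d : nat) (phi : nat -> d.-tuple R -> R)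
    (n : nat) : d.-tuple R -> R :=
  fun x => 3 / 2 * phi n x - 1 / 2 * phi n.-1 x.

Definition midpoint (R : realType) (d : nat) (phi : nat -> d.-tuple R -> R)
    (n : nat) : d.-tuple R -> R :=
  fun x => 1 / 2 * (phi n.+1 x + phi n x).

(* [gmm] stands for (G mu, mu). *)
Definition relaxation_set (R : realType) (dt eta qt Qnew gmm : R) : set R :=
  [set xi | 0 <= xi <= 1 /\
    (xi * qt + (1 - xi) * Qnew) ^+ 2 - qt ^+ 2 <= dt * eta * gmm].

(* [mu n] is the half-step unknown mu^(n+1/2); [qt n.+1] and [q n] are the
   auxiliary scalars before and after relaxation. *)
Definition RSAV_CN_step (R : realType) (d : nat) (a b : d.-tuple R)
    (L : (d.-tuple R -> R) -> (d.-tuple R -> R))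
    (DG : set (d.-tuple R -> R)) (G : (d.-tuple R -> R) -> (d.-tuple R -> R))
    (F : R -> R) (gamma0 C0 dt eta : R)
    (phi mu : nat -> d.-tuple R -> R) (qt q : nat -> R) (n : nat) : Prop :=
  let phibar := extrapolate phi n in
  let phihalf := midpoint phi n in
  let qthalf := 1 / 2 * (qt n.+1 + q n) in
  let Qbar := Q a b F gamma0 C0 phibar in
  let Qnew := Q a b F gamma0 C0 (phi n.+1) in
  let Vbar := V F gamma0 phibar in
  [/\ [/\ DG (mu n), periodicL2 a b Vbar, Q_admissible a b F gamma0 C0 phibar &
          Q_admissible a b F gamma0 C0 (phi n.+1)],
      forall x, (phi n.+1 x - phi n x) / dt = - G (mu n) x,
      forall x, mu n x =
        L phihalf x + gamma0 * phihalf x + qthalf / Qbar * Vbar x,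
      (qt n.+1 - q n) / dt =
        integral_box a b
          (fun x => Vbar x / (2 * Qbar) * ((phi n.+1 x - phi n x) / dt)) &
      exists2 xi, xi \in relaxation_set dt eta (qt n.+1) Qnew
                            (dot a b (G (mu n)) (mu n)) &
        q n.+1 = xi * qt n.+1 + (1 - xi) * Qnew].

Definition RSAV_CN_scheme (R : realType) (d : nat) (a b : d.-tuple R)
    (DL : set (d.-tuple R -> R)) (L : (d.-tuple R -> R) -> (d.-tuple R -> R))
    (DG : set (d.-tuple R -> R)) (G : (d.-tuple R -> R) -> (d.-tuple R -> R))
    (F : R -> R) (gamma0 C0 dt eta : R) (N : nat)
    (phi mu : nat -> d.-tuple R -> R) (qt q : nat -> R) : Prop :=
  [/\ periodicL2 a b (phi 0%N),
      forall n, (1 <= n <= N)%N -> DL (phi n) &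
      forall n, (1 <= n <= N.-1)%N ->
        RSAV_CN_step a b L DG G F gamma0 C0 dt eta phi mu qt q n].

Definition E_CN (R : realType) (d : nat) (a b : d.-tuple R)
    (L : (d.-tuple R -> R) -> (d.-tuple R -> R)) (gamma0 : R)
    (phi : nat -> d.-tuple R -> R) (q : nat -> R) (n : nat) : R :=
  1 / 2 * dot a b (phi n) (fun x => L (phi n) x + gamma0 * phi n x) + q n ^+ 2.

(* Main.v *)
Require Import Defs.
From mathcomp Require Import all_boot all_order all_algebra.
From mathcomp Require Import all_classical all_reals all_analysis.
Set Implicit Arguments.
Unset Strict Implicit.
Unset Printing Implicit Defensive.
Import Order.TTheory GRing.Theory Num.Theory.
Import numFieldNormedType.Exports.
Local Open Scope classical_set_scope.
Local Open Scope ring_scope.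

From mathcomp Require Import measurable_realfun ring lra.

(** The scheme is a discrete chain rule.  Test the equation for the chemical
    potential [mu] with the increment [phi n.+1 - phi n = - dt * G mu]:
    - on the left stands [- dt * (G mu, mu)], minus the dissipation;
    - since the quadratic part is evaluated at the midpoint and [L] is
      symmetric, [(u - v, M ((u + v) / 2)) = ((u, M u) - (v, M v)) / 2] for
      [M = L + gamma0 I] gives exactly the increment of the quadratic energy
      ([midpoint_increment]);
    - the nonlinear term pairs [V / Q] with the same increment, which the update
      of the auxiliary scalar turns into [(qt + q) * (qt - q)], an exact
      difference of squares.
    Hence the energy with [qt n.+1] in place of [q n.+1] drops by exactly
    [dt * (G mu, mu)] ([unrelaxed_energy_balance]).  Relaxation may put back at
    most the fraction [eta <= 1] of this amount, and [(G mu, mu) >= 0].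

    All pairings are integrals of products of square integrable functions, so
    that they are finite and bilinear; this is where the analysis enters. *)

(** [`|f g| <= f ^ 2 + g ^ 2]. *)
Lemma periodicL2_mul_integrable (R : realType) (d : nat) (a b : d.-tuple R)
    (f g : d.-tuple R -> R) :
  periodicL2 a b f -> periodicL2 a b g ->
  (lebesgue R d).-integrable (box a b) (EFin \o (fun x => f x * g x)).
Proof.
move=> [_ mf f2] [_ mg g2].
have mbox := measurable_box a b.
have fg2 := integrableD mbox f2 g2.
apply: (le_integrable mbox _ _ fg2).
  by apply/measurable_EFinP; exact: measurable_funM.
move=> x _ /=; rewrite lee_fin normrM [leRHS]ger0_norm ?addr_ge0 ?sqr_ge0//.
rewrite -[f x ^+ 2]real_normK ?num_real// -[g x ^+ 2]real_normK ?num_real//.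
have := sqr_ge0 (`|f x| - `|g x|).
have := sqr_ge0 `|f x|; have := sqr_ge0 `|g x|; nra.
Qed.

Lemma periodicL2D (R : realType) (d : nat) (a b : d.-tuple R) (c : R)
    (f g : d.-tuple R -> R) :
  periodicL2 a b f -> periodicL2 a b g ->
  periodicL2 a b (fun x => c * f x + g x).
Proof.
move=> Lf Lg; have ifg := periodicL2_mul_integrable Lf Lg.
case: Lf Lg => [pf mf f2] [pg mg g2].
have mbox := measurable_box a b.
split; first by move=> i x; rewrite pf pg.
  by apply: measurable_funD => //; exact: measurable_funM.
apply: (eq_integrable mbox _ _ _ (integrableD mbox
  (integrableD mbox (integrableZl mbox (c ^+ 2) f2)
                    (integrableZl mbox (2 * c) ifg)) g2)).
by move=> x _ /=; rewrite -!EFinM -!EFinD; congr EFin; ring.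
Qed.

Lemma dotC (R : realType) (d : nat) (a b : d.-tuple R) (f g : d.-tuple R -> R) :
  dot a b f g = dot a b g f.
Proof. by congr integral_box; apply/funext => x; rewrite mulrC. Qed.

Lemma dotZl (R : realType) (d : nat) (a b : d.-tuple R) (c : R)
    (f g : d.-tuple R -> R) :
  periodicL2 a b f -> periodicL2 a b g ->
  dot a b (fun x => c * f x) g = c * dot a b f g.
Proof.
move=> Lf Lg; rewrite /dot /integral_box -RintegralZl.
- by apply: eq_Rintegral => x _; rewrite mulrA.
- exact: measurable_box.
- exact: periodicL2_mul_integrable.
Qed.

Lemma dotDl (R : realType) (d : nat) (a b : d.-tuple R) (c : R)
    (f g h : d.-tuple R -> R) :
  periodicL2 a b f -> periodicL2 a b g -> periodicL2 a b h ->
  dot a b (fun x => c * f x + g x) h = c * dot a b f h + dot a b g h.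
Proof.
move=> Lf Lg Lh; have mbox := measurable_box a b.
have ifh := periodicL2_mul_integrable Lf Lh.
rewrite /dot /integral_box -RintegralZl// -RintegralD//.
- by apply: eq_Rintegral => x _; rewrite mulrDl mulrA.
- apply: (eq_integrable mbox _ _ _ (integrableZl mbox c ifh)) => x _ /=.
  by rewrite EFinM.
- exact: periodicL2_mul_integrable.
Qed.

Lemma dotDr (R : realType) (d : nat) (a b : d.-tuple R) (c : R)
    (f g h : d.-tuple R -> R) :
  periodicL2 a b f -> periodicL2 a b g -> periodicL2 a b h ->
  dot a b h (fun x => c * f x + g x) = c * dot a b h f + dot a b h g.
Proof. by move=> Lf Lg Lh; rewrite dotC dotDl// !(dotC a b h). Qed.

(** In the skew-symmetric case [(G f, f)] is its own opposite. *)
Lemma dissipation_ge0 (R : realType) (d : nat) (a b : d.-tuple R)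
    (D : set (d.-tuple R -> R)) (G : (d.-tuple R -> R) -> (d.-tuple R -> R))
    (f : d.-tuple R -> R) :
  positive_semidefinite_on a b D G \/ skew_symmetric_on a b D G -> D f ->
  0 <= dot a b (G f) f.
Proof.
move=> [pG|sG] Df; first exact: pG.
by have := sG f f Df Df; rewrite [in X in - X]dotC; lra.
Qed.

(** For symmetric [L] the cross terms [(u, L v)] and [(v, L u)] cancel, so the
    midpoint rule integrates the gradient of the quadratic energy exactly.
    Increment and gradient have the shape [c * f + g] on which [linear_on] and
    the bilinearity of [dot] act. *)
Lemma midpoint_increment (R : realType) (d : nat) (a b : d.-tuple R)
    (D : set (d.-tuple R -> R)) (L : (d.-tuple R -> R) -> (d.-tuple R -> R))
    (gamma : R) (phi : nat -> d.-tuple R -> R) (n : nat) :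
  operator_on a b D L -> linear_on D L -> symmetric_on a b D L ->
  D (phi n.+1) -> D (phi n) ->
  let h := midpoint phi n in
  periodicL2 a b h /\ periodicL2 a b (L h) /\
  dot a b (fun x => (-1) * phi n x + phi n.+1 x)
          (fun x => gamma * h x + L h x) =
  1 / 2 * dot a b (phi n.+1) (fun x => L (phi n.+1) x + gamma * phi n.+1 x) -
  1 / 2 * dot a b (phi n) (fun x => L (phi n) x + gamma * phi n x).
Proof.
move=> [DL2 LL2] [_ linL] symL.
set u := phi n.+1; set v := phi n => Du Dv h.
pose w x := (-1) * v x + u x.
have [Dw Lw] := linL (-1) v u Dv Du.
(* The midpoint is half an increment past [v], a single linear combination. *)
have hE : h = (fun x => 1 / 2 * w x + v x).
  by apply/funext => x; rewrite /h /midpoint /w -/u -/v; field.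
have [Dh Lh] := linL (1 / 2) w v Dw Dv.
rewrite -hE in Dh Lh.
have [u2 v2 w2 h2] := And4 (DL2 _ Du) (DL2 _ Dv) (DL2 _ Dw) (DL2 _ Dh).
have [Lu2 Lv2 Lw2 Lh2] := And4 (LL2 _ Du) (LL2 _ Dv) (LL2 _ Dw) (LL2 _ Dh).
split=> //; split=> //.
have energyE f : D f -> dot a b f (fun x => L f x + gamma * f x) =
    gamma * dot a b f f + dot a b f (L f).
  move=> Df; rewrite -dotDr; [|exact: DL2|exact: LL2|exact: DL2].
  by congr dot; apply/funext => x; rewrite addrC.
rewrite !energyE// dotDr// Lh dotDr// [in dot a b _ h]hE dotDr// Lw dotDr//.
rewrite !dotDl// dotDr// dotDr//.
have := symL u v Du Dv; rewrite (dotC a b (L u)) (dotC a b v u) => ->.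
by field.
Qed.

(** Both the third term of the chemical potential and the update of the
    auxiliary scalar carry the factor [V / Q]; eliminating it yields
    [(qt + q) * (qt - q)]. *)
Lemma unrelaxed_energy_balance (R : realType) (d : nat) (a b : d.-tuple R)
    (DL : set (d.-tuple R -> R)) (L : (d.-tuple R -> R) -> (d.-tuple R -> R))
    (DG : set (d.-tuple R -> R)) (G : (d.-tuple R -> R) -> (d.-tuple R -> R))
    (F : R -> R) (gamma0 C0 dt eta : R)
    (phi mu : nat -> d.-tuple R -> R) (qt q : nat -> R) (n : nat) :
  operator_on a b DL L -> linear_on DL L -> symmetric_on a b DL L ->
  operator_on a b DG G -> 0 < dt -> DL (phi n) -> DL (phi n.+1) ->
  RSAV_CN_step a b L DG G F gamma0 C0 dt eta phi mu qt q n ->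
  E_CN a b L gamma0 phi qt n.+1 =
  E_CN a b L gamma0 phi q n - dt * dot a b (G (mu n)) (mu n).
Proof.
move=> opL linL symL [DG2 GL2] dt_gt0 Dv Du.
move=> [[Dmu V2 [_ Qsq_gt0] _] phiE muE qtE _].
have [DL2 _] := opL.
have [h2 [Lh2 incr]] := midpoint_increment gamma0 opL linL symL Du Dv.
have dt0 : dt != 0 by rewrite gt_eqF.
rewrite /= in incr qtE.
set h := midpoint phi n in h2 Lh2 incr muE.
set Vb := V F gamma0 _ in V2 muE qtE.
set Qb := Q _ _ _ _ _ _ in muE qtE.
have Qb0 : Qb != 0 by rewrite gt_eqF// sqrtr_gt0.
pose w x := (-1) * phi n x + phi n.+1 x.
have w2 : periodicL2 a b w by apply: periodicL2D; exact: DL2.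
have wE : w = (fun x => - dt * G (mu n) x).
  by apply/funext => x; rewrite -[G _ x]opprK -phiE /w; field.
have muE' : mu n = (fun x => 1 / 2 * (qt n.+1 + q n) / Qb * Vb x +
                              (gamma0 * h x + L h x)).
  by apply/funext => x; rewrite muE; ring.
have qtE' : 2 * Qb * (qt n.+1 - q n) = dot a b w Vb.
  have -> : dot a b w Vb = 2 * Qb * dt * ((qt n.+1 - q n) / dt); last by field.
  rewrite qtE dotC /dot /integral_box -RintegralZl; last 2 first.
  - exact: measurable_box.
  - have i := periodicL2_mul_integrable V2 w2.
    apply: (eq_integrable (measurable_box a b) _ _ _
      (integrableZl (measurable_box a b) (2 * Qb * dt)^-1 i)) => x _ /=.
    by rewrite -EFinM /w; congr EFin; field; rewrite dt0.
  by apply: eq_Rintegral => x _; rewrite /w; field; rewrite dt0.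
have diss : dot a b w (mu n) = - dt * dot a b (G (mu n)) (mu n).
  by rewrite wE dotZl//; [exact: GL2|exact: DG2].
move: diss; rewrite {1}muE' dotDr//; last exact: periodicL2D.
rewrite incr -qtE' => diss.
rewrite /E_CN -mulNr -diss.
by field.
Qed.

Theorem theorem3p2 (R : realType) (d : nat) (a b : d.-tuple R)
  (hd : (0 < d)%N) (hab : forall i, tnth a i < tnth b i)
  (DL : set (d.-tuple R -> R)) (L : (d.-tuple R -> R) -> (d.-tuple R -> R))
  (DG : set (d.-tuple R -> R)) (G : (d.-tuple R -> R) -> (d.-tuple R -> R))
  (F : R -> R) (gamma0 C0 : R)
  (hL : operator_on a b DL L) (hLlin : linear_on DL L)
  (hLsym : symmetric_on a b DL L)
  (hG : operator_on a b DG G)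
  (hGpos : positive_semidefinite_on a b DG G \/ skew_symmetric_on a b DG G)
  (hF : C1 F) (hC0 : 0 < C0)
  (dt eta : R) (hdt : 0 < dt) (heta : 0 <= eta <= 1)
  (N : nat) (phi mu : nat -> d.-tuple R -> R) (qt q : nat -> R)
  (hscheme : RSAV_CN_scheme a b DL L DG G F gamma0 C0 dt eta N phi mu qt q) :
  forall n : nat, (1 <= n <= N.-1)%N ->
    E_CN a b L gamma0 phi q n.+1 <= E_CN a b L gamma0 phi q n.
Proof.
move=> n /andP[n1 nN]; have [_ Dphi step] := hscheme.
have nltN : (n < N)%N.
  rewrite (leq_ltn_trans nN)// ltn_predL lt0n.
  by apply: contraTneq (leq_trans n1 nN) => ->.
have Dv : DL (phi n) by apply: Dphi; rewrite n1 ltnW.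
have Du : DL (phi n.+1) by apply: Dphi.
have st := step n (introT andP (conj n1 nN)).
have bal := unrelaxed_energy_balance hL hLlin hLsym hG hdt Dv Du st.
case: st => [[Dmu _ _ _] _ _ _ [xi]]; rewrite inE => -[_ relax] qE.
have diss := dissipation_ge0 hGpos Dmu.
rewrite -qE in relax.
move: bal; rewrite /E_CN => bal.
case/andP: heta => _ eta1.
have : dt * eta * dot a b (G (mu n)) (mu n) <= dt * dot a b (G (mu n)) (mu n).
  by rewrite ler_wpM2r// ler_piMr// ltW.
lra.
Qed.
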